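(* Let $\rho>0$, let $m\ge 1$ be an integer, let $a\in\mathbb{R}^{1\times m}$ be a row vector, $x_0\in\mathbb{R}^{m}$ a column vector, and $b_1,b_2\in\mathbb{R}$ scalars. Consider the optimization problem over row vectors $\Phi\in\mathbb{R}^{1\times m}$ $$\min_{\Phi}\ |\Phi x_0|^2+\frac{\rho}{2}\|\Phi-a\|_2^2\quad\text{subject to}\quad b_2\le \Phi x_0\le b_1,$$ and assume it is feasible (there is at least one $\Phi$ satisfying the constraint). Let $M:=(2x_0x_0^{\mathsf T}+\rho I)^{-1}$. Then the optimal solution of this problem is $$\Phi^\star=(\rho a-\lambda x_0^{\mathsf T})\,(2x_0x_0^{\mathsf T}+\rho I)^{-1},$$ where $$\lambda=\begin{cases}\dfrac{\rho a M x_0-b_1}{x_0^{\mathsf T}Mx_0} & \text{if } \rho aMx_0-b_1>0,\\[2mm] \dfrac{\rho a M x_0-b_2}{x_0^{\mathsf T}Mx_0} & \text{if } \rho aMx_0-b_2<0,\\[2mm] 0 & \text{otherwise.}\end{cases}$$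
   Context: $I$ denotes the $m\times m$ identity matrix and $\|\cdot\|_2$ the Euclidean norm. *)

(* Defs.v *)
From mathcomp Require Import all_boot all_order all_algebra.
From mathcomp Require Import reals.

Set Implicit Arguments.
Unset Strict Implicit.
Unset Printing Implicit Defensive.

Import Order.TTheory GRing.Theory Num.Theory.
Local Open Scope ring_scope.

(* Euclidean norm; MathComp-Analysis's norm on matrices is the sup norm. *)
Definition l2norm (R : realType) (n : nat) (v : 'rV[R]_n) : R :=
  Num.sqrt (\sum_(j < n) v 0 j ^+ 2).

(* The scalar identified with a 1 x 1 matrix. *)
Definition scal (R : realType) (A : 'M[R]_1) : R := A 0 0.

Definition optimal_solution (R : realType) (T : Type)
    (feasible : T -> Prop) (f : T -> R) (x : T) : Prop :=
  feasible x /\ forall y : T, feasible y -> f x <= f y.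

(* Main.v *)
Require Import Defs.
From mathcomp Require Import all_boot all_order all_algebra.
From mathcomp Require Import reals.
From mathcomp Require Import ring lra.

Set Implicit Arguments.
Unset Strict Implicit.
Unset Printing Implicit Defensive.

Import Order.TTheory GRing.Theory Num.Theory.
Local Open Scope ring_scope.

(** The objective is a strictly convex quadratic and the constraint is an
    interval for the scalar [Phi x0], so the problem is solved by its KKT
    conditions, and the gap to the optimum can be computed exactly.

    Write [A = 2 x0 x0^T + rho I], which is positive definite, and let
    [P = (rho a - lambda x0^T) A^-1].  The equation [P A = rho a - lambda x0^T]
    says that the Lagrangian with multiplier [lambda] is stationary at [P].
    Completing the square around such a [P] gives, for every [Y] and with
    [d = Y x0 - P x0],

      [f Y = f P + d ^+ 2 + rho / 2 * |Y - P| ^+ 2 - lambda * d]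

    ([objective_gap]).  Hence [P] is the unique minimizer as soon as it is
    feasible and [lambda * d <= 0] for every feasible [Y]
    ([kkt_optimal_unique]).

    Both conditions follow from [P x0 = c - lambda s], where
    [s = x0^T A^-1 x0] and [c = rho a A^-1 x0] is the value of [Phi x0] at the
    unconstrained minimizer: [lambda s] is exactly the amount needed to move [c]
    to the nearest end of [[b2, b1]] when it lies outside, and [lambda] has the
    same sign because [s >= 0] ([clamping_multiplier]).  The one degenerate
    case is [s = 0], which forces [x0 = 0] and [c = 0]; the constraint then
    reads [b2 <= 0 <= b1], so feasibility alone selects the branch
    [lambda = 0]. *)

Section Scalars.
Variable R : realType.

Lemma scalD (A B : 'M[R]_1) : scal (A + B) = scal A + scal B.
Proof. by rewrite /scal mxE. Qed.

Lemma scalB (A B : 'M[R]_1) : scal (A - B) = scal A - scal B.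
Proof. by rewrite /scal !mxE. Qed.

Lemma scalZ k (A : 'M[R]_1) : scal (k *: A) = k * scal A.
Proof. by rewrite /scal mxE. Qed.

Lemma scal_tr (A : 'M[R]_1) : scal A^T = scal A.
Proof. by rewrite /scal mxE. Qed.

Lemma scal_mul_tr n (v : 'rV[R]_n) :
  scal (v *m v^T) = \sum_(j < n) v 0 j ^+ 2.
Proof. by rewrite /scal mxE; apply: eq_bigr => j _; rewrite mxE expr2. Qed.

Lemma scal_mul_tr_ge0 n (v : 'rV[R]_n) : 0 <= scal (v *m v^T).
Proof. by rewrite scal_mul_tr sumr_ge0 // => j _; rewrite sqr_ge0. Qed.

Lemma scal_mul_tr_eq0 n (v : 'rV[R]_n) : scal (v *m v^T) = 0 -> v = 0.
Proof.
rewrite scal_mul_tr => /eqP; rewrite psumr_eq0 => [/allP v0|j _]; last first.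
  by rewrite sqr_ge0.
apply/rowP => j; rewrite mxE; apply/eqP.
by rewrite -[_ == 0](sqrf_eq0 (v 0 j)); apply: v0; rewrite mem_index_enum.
Qed.

Lemma sqr_l2norm n (v : 'rV[R]_n) : l2norm v ^+ 2 = scal (v *m v^T).
Proof. by rewrite /l2norm -scal_mul_tr sqr_sqrtr ?scal_mul_tr_ge0. Qed.

End Scalars.

Section Hessian.
Variables (R : realType) (rho : R) (m : nat) (x0 : 'cV[R]_m).
Hypothesis rho_gt0 : 0 < rho.

Definition hessian : 'M[R]_m := 2 *: (x0 *m x0^T) + rho *: 1%:M.

Lemma mul_hessian (u : 'rV[R]_m) :
  u *m hessian = (2 * scal (u *m x0)) *: x0^T + rho *: u.
Proof.
rewrite /hessian mulmxDr -!scalemxAr mulmx1 mulmxA.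
by rewrite {1}[u *m x0]mx11_scalar mul_scalar_mx scalerA.
Qed.

(** Positive definiteness: with [A] the Hessian,
    [u A u^T = 2 (u x0) ^+ 2 + rho |u| ^+ 2] vanishes only at [u = 0], so [A]
    has a trivial kernel. *)
Lemma hessian_unit : hessian \in unitmx.
Proof.
rewrite -row_free_unit -kermx_eq0; apply/rowV0P => u /sub_kermxP uA0.
apply: scal_mul_tr_eq0; apply/eqP; rewrite eq_le scal_mul_tr_ge0 andbT.
have := congr1 (fun v => scal (v *m u^T)) uA0.
rewrite mul_hessian mulmxDl -!scalemxAl scalD !scalZ mul0mx -trmx_mul scal_tr.
rewrite [scal 0]mxE => eq0.
rewrite -(pmulr_rle0 _ rho_gt0).
by have := sqr_ge0 (scal (u *m x0)); rewrite expr2; lra.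
Qed.

(** Multiplying [(x0^T A^-1) A = x0^T] by [x0] on the right gives
    [s * (2 |x0| ^+ 2 + rho) = |x0| ^+ 2] for [s = x0^T A^-1 x0], which settles
    both the sign of [s] and its vanishing. *)
Lemma invmx_hessian_form :
  let s := scal (x0^T *m invmx hessian *m x0) in
  0 <= s /\ (s = 0 -> x0 = 0).
Proof.
move=> s; set n := scal (x0^T *m x0).
have n_ge0 : 0 <= n by rewrite /n -{2}[x0]trmxK scal_mul_tr_ge0.
have sE : s * (2 * n + rho) = n.
  have := mul_hessian (x0^T *m invmx hessian).
  rewrite mulmxKV ?hessian_unit // => /(congr1 (fun v => scal (v *m x0))).
  by rewrite mulmxDl -!scalemxAl scalD !scalZ -/s -/n => {2}->; ring.
have k_gt0 : 0 < 2 * n + rho by rewrite ltr_wpDl // mulr_ge0.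
split; first by rewrite -(pmulr_lge0 _ k_gt0) sE.
move=> s0; apply: trmx_inj; rewrite trmx0; apply: scal_mul_tr_eq0.
by rewrite trmxK -/n -sE s0 mul0r.
Qed.

End Hessian.

Section Optimality.
Variables (R : realType) (rho : R) (m : nat).
Variables (a : 'rV[R]_m) (x0 : 'cV[R]_m).

Let objective (Phi : 'rV[R]_m) : R :=
  `|scal (Phi *m x0)| ^+ 2 + rho / 2 * l2norm (Phi - a) ^+ 2.

(** The first-order term of the objective at a stationary point of the
    Lagrangian is [- lambda] times the variation of the constraint; the
    remaining terms are the (exact) second-order ones. *)
Lemma objective_gap (lambda : R) (P Y : 'rV[R]_m) :
  P *m hessian rho x0 = rho *: a - lambda *: x0^T ->
  let d := scal (Y *m x0) - scal (P *m x0) in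
  objective Y = objective P + d ^+ 2
    + rho / 2 * scal ((Y - P) *m (Y - P)^T) - lambda * d.
Proof.
rewrite mul_hessian => stat d.
have [D YE] : exists D, Y = P + D by exists (Y - P); rewrite addrC subrK.
have PD : rho * scal ((P - a) *m D^T) = - (lambda + 2 * scal (P *m x0)) * d.
  have -> : d = scal (x0^T *m D^T).
    by rewrite /d YE mulmxDl scalD -trmx_mul scal_tr; ring.
  rewrite -[LHS]scalZ -[RHS]scalZ !scalemxAl; congr (scal (_ *m _)).
  rewrite scalerBr -(subrK (lambda *: x0^T) (rho *: a)) -stat.
  apply/rowP => j; rewrite !mxE; ring.
rewrite /objective !sqr_l2norm !real_normK ?num_real //.
have -> : Y - P = D by rewrite YE addrC addKr.
have -> : Y - a = (P - a) + D by rewrite YE addrAC.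
have -> : scal (Y *m x0) = scal (P *m x0) + d by rewrite /d addrC subrK.
rewrite linearD /= mulmxDl !mulmxDr !scalD.
have -> : scal (D *m (P - a)^T) = scal ((P - a) *m D^T).
  by rewrite -scal_tr trmx_mul trmxK.
move: PD; set e := scal ((P - a) *m D^T) => PD.
have -> : lambda * d = - (rho * e + 2 * scal (P *m x0) * d) by rewrite PD; ring.
by field.
Qed.

(** When [lambda * d <= 0] every term of the gap is nonnegative, so [P] is
    optimal; when moreover the gap is nonpositive, the term
    [rho / 2 * |Y - P| ^+ 2] must vanish, which gives uniqueness. *)
Lemma kkt_optimal_unique (feasible : 'rV[R]_m -> Prop) (lambda : R)
    (P : 'rV[R]_m) :
  0 < rho ->
  P *m hessian rho x0 = rho *: a - lambda *: x0^T ->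
  feasible P ->
  (forall Y, feasible Y ->
     lambda * (scal (Y *m x0) - scal (P *m x0)) <= 0) ->
  forall Phi, optimal_solution feasible objective Phi <-> Phi = P.
Proof.
move=> rho_gt0 stat feasP slack Phi.
have r2_gt0 : 0 < rho / 2 by rewrite divr_gt0.
split=> [[feasPhi optPhi]|->].
  have := optPhi P feasP; rewrite (objective_gap Phi stat).
  have := slack Phi feasPhi.
  have := sqr_ge0 (scal (Phi *m x0) - scal (P *m x0)).
  move=> d_ge0 slackPhi gap; apply/eqP; rewrite -subr_eq0; apply/eqP.
  apply: scal_mul_tr_eq0; apply/eqP; rewrite eq_le scal_mul_tr_ge0 andbT.
  by rewrite -(pmulr_rle0 _ r2_gt0); lra.
split=> // Y feasY; rewrite (objective_gap Y stat).
have := slack Y feasY.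
have := sqr_ge0 (scal (Y *m x0) - scal (P *m x0)).
have := mulr_ge0 (ltW r2_gt0) (scal_mul_tr_ge0 (Y - P)).
lra.
Qed.

End Optimality.

(** If [c] lies outside the interval, [lambda * s] is the excess [c - b1] or
    [c - b2], so the shifted value is an active endpoint; every other feasible
    value lies on the inner side of it, opposite to the sign of [lambda].  The
    hypothesis on [s = 0] makes sure that an excess is only ever divided by a
    positive [s]. *)
Lemma clamping_multiplier (R : realType) (b1 b2 c s : R) :
  b2 <= b1 -> 0 <= s -> (s = 0 -> b2 <= c <= b1) ->
  let lambda :=
    if 0 < c - b1 then (c - b1) / s
    else if c - b2 < 0 then (c - b2) / s
    else 0 in
  b2 <= c - lambda * s <= b1 /\
  (forall y, b2 <= y <= b1 -> lambda * (y - (c - lambda * s)) <= 0).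
Proof.
move=> b21 s_ge0 s0 lambda; rewrite /lambda.
have s_gt0 : ~~ (b2 <= c <= b1) -> 0 < s.
  move=> cNb; rewrite lt_neqAle s_ge0 andbT eq_sym.
  by apply: contraNneq cNb => /s0.
case: ifPn => [cb1|]; last rewrite -leNgt => cb1; last case: ifPn => [cb2|].
- have sp : 0 < s by apply: s_gt0; apply/negP => /andP[_]; lra.
  rewrite divfK ?gt_eqF // subKr lexx b21; split=> // y /andP[_ yb1].
  by rewrite pmulr_rle0 ?subr_le0 // divr_gt0.
- have sp : 0 < s by apply: s_gt0; apply/negP => /andP[]; lra.
  rewrite divfK ?gt_eqF // subKr lexx b21; split=> // y /andP[b2y _].
  by rewrite nmulr_rle0 ?subr_ge0 // pmulr_llt0 ?invr_gt0.
rewrite -leNgt => cb2; rewrite mul0r subr0; split=> [|y _].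
  by apply/andP; split; lra.
by rewrite mul0r.
Qed.

Theorem lemma2 (R : realType) (rho : R) (hrho : 0 < rho)
    (m : nat) (hm : (1 <= m)%N)
    (a : 'rV[R]_m) (x0 : 'cV[R]_m) (b1 b2 : R) :
  let feasible := fun Phi : 'rV[R]_m => b2 <= scal (Phi *m x0) <= b1 in
  let objective := fun Phi : 'rV[R]_m =>
    `|scal (Phi *m x0)| ^+ 2 + rho / 2 * l2norm (Phi - a) ^+ 2 in
  let M : 'M[R]_m := invmx (2 *: (x0 *m x0^T) + rho *: 1%:M) in
  let c := rho * scal (a *m M *m x0) in
  let lambda :=
    if 0 < c - b1 then (c - b1) / scal (x0^T *m M *m x0)
    else if c - b2 < 0 then (c - b2) / scal (x0^T *m M *m x0)
    else 0 in
  (exists Phi, feasible Phi) ->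
  forall Phi : 'rV[R]_m,
    optimal_solution feasible objective Phi <->
    Phi = (rho *: a - lambda *: x0^T) *m M.
Proof.
move=> feasible objective M c lambda [Phi0 feasPhi0].
have MA : M = invmx (hessian rho x0) by [].
have [s_ge0 s_eq0] := invmx_hessian_form x0 hrho.
rewrite -MA in s_ge0 s_eq0.
have b21 : b2 <= b1 by have /andP[le1 le2] := feasPhi0; apply: le_trans le2.
have degenerate : scal (x0^T *m M *m x0) = 0 -> b2 <= c <= b1.
  move=> /s_eq0 x00; move: feasPhi0; rewrite /feasible /c x00 !mulmx0.
  by rewrite [scal 0]mxE mulr0.
have [clamped slack] := clamping_multiplier b21 s_ge0 degenerate.
set P := _ *m M.
have PxE : scal (P *m x0) = c - lambda * scal (x0^T *m M *m x0).
  by rewrite /P !mulmxBl -!scalemxAl scalB !scalZ.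
apply: (@kkt_optimal_unique _ _ _ _ _ feasible lambda) => //.
- by rewrite /P MA mulmxKV ?hessian_unit.
- by rewrite /feasible PxE.
by move=> Y feasY; rewrite PxE; apply: slack.
Qed.
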